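(* Let $(R,\mathfrak m,k)$ be a Noetherian local F-finite reduced ring of prime characteristic $p>0$. (1) Let $q=p^e$ with $e>0$ and let $\phi: R^{1/q}\to R$ be an $R$-linear map, with associated test ideal $\tau(R,\phi)$. Then $\tau(R,\phi)$ is a strong test ideal for $R$. (2) Moreover, if $(R,\mathscr D)$ is a Cartier algebra pair on $R$, with associated test ideal $\tau(R,\mathscr D)$, then $\tau(R,\mathscr D)$ is a strong test ideal for $R$.
   Context: $R^o$ denotes the complement in $R$ of the union of the minimal primes of $R$. For $q=p^e$, $R^{1/q}\supseteq R$ is the ring of $q$-th roots of elements of $R$ (well defined since $R$ is reduced), and for an ideal $J$ of $R$, $J^{1/q}\subseteq R^{1/q}$ is the set of $q$-th roots of elements of $J$. For an ideal $I$, $I^{[q]}$ is the ideal generated by the $q$-th powers of the elements of $I$. The tight closure of an ideal $I$ is $I^*=\{x\in R:\ \text{there exists } c\in R^o \text{ such that } cx^q\in I^{[q]} \text{ for all } q=p^e\gg 0\}$. A strong test ideal for $R$ is an ideal $T$ of $R$ with $T\cap R^o\neq\emptyset$ such that $TI^*=TI$ for all ideals $I$ of $R$. An ideal $J$ of $R$ is $\phi$-compatible if $\phi(J^{1/q})\subseteq J$. The test ideal $\tau(R,\phi)$ is the unique smallest (with respect to inclusion) $\phi$-compatible ideal $J$ with $J\cap R^o\neq\emptyset$. The Cartier algebra on $R$ is the graded (noncommutative) ring $\mathscr C=\bigoplus_{e\ge 0}\mathscr C_e$, $\mathscr C_e=\operatorname{Hom}_R(R^{1/p^e},R)$, where the product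 of $\phi\in\mathscr C_e$ and $\psi\in\mathscr C_d$ is $\phi\circ\psi^{1/p^e}\in\mathscr C_{e+d}$, with $\psi^{1/p^e}:R^{1/p^{e+d}}\to R^{1/p^e}$ given by $\psi^{1/p^e}(s^{1/p^e})=\psi(s)^{1/p^e}$. A Cartier algebra pair $(R,\mathscr D)$ consists of $R$ and a graded subring $\mathscr D$ of $\mathscr C$ such that $\mathscr D_0=\mathscr C_0\simeq R$ and $\mathscr D_e\neq 0$ for some $e>0$. An ideal $J$ of $R$ is $\mathscr D$-compatible if $\phi(J^{1/p^e})\subseteq J$ for all $e>0$ and all $\phi\in\mathscr D_e$. The test ideal $\tau(R,\mathscr D)$ is the unique smallest $\mathscr D$-compatible ideal $J$ with $J\cap R^o\ne\emptyset$. The existence of the test ideals $\tau(R,\phi)$ and $\tau(R,\mathscr D)$ is part of the setting: the statement concerns these ideals as defined objects. *)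

(* Defs.v *)
From HB Require Import structures.
From mathcomp Require Import all_boot all_algebra.
From mathcomp Require Import boolp classical_sets.

Set Implicit Arguments.
Unset Strict Implicit.
Unset Printing Implicit Defensive.

Import GRing.Theory.
Local Open Scope classical_set_scope.
Local Open Scope ring_scope.

Section Ideals.
Variable R : comNzRingType.
Implicit Types (I J M P T A : set R).

(* Unlike [idealr_closed] of ring_quotient, the unit ideal is allowed. *)
Definition is_ideal I :=
  [/\ I 0, (forall x y, I x -> I y -> I (x + y))
    & forall a x, I x -> I (a * x)].

Definition ideal_gen A : set R := smallest is_ideal A.

Definition ideal_mul I J : set R :=
  ideal_gen [set z | exists x y, [/\ I x, J y & z = x * y]].

Definition prime_ideal P :=
  [/\ is_ideal P, ~ P 1 & forall x y, P (x * y) -> P x \/ P y].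

Definition minimal_prime P :=
  prime_ideal P /\ forall Q, prime_ideal Q -> Q `<=` P -> Q = P.

Definition maximal_ideal M :=
  [/\ is_ideal M, ~ M 1
    & forall J, is_ideal J -> ~ J 1 -> M `<=` J -> J = M].

Definition local_ring M :=
  maximal_ideal M /\ forall M', maximal_ideal M' -> M' = M.

Definition noetherian :=
  forall I, is_ideal I -> exists s : seq R, I = ideal_gen [set` s].

Definition reduced := forall (x : R) (n : nat), x ^+ n = 0 -> x = 0.

(* The set written R^o in the literature (not the regular module [R^o]). *)
Definition off_min_primes : set R :=
  ~` \bigcup_(P in [set P | minimal_prime P]) P.

(* The q-th Frobenius power of I. *)
Definition frob_power I (q : nat) : set R := ideal_gen [set x ^+ q | x in I].

Definition tight_closure (p : nat) I : set R :=
  [set x | exists2 c, off_min_primes c &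
     exists N : nat, forall e : nat, (N <= e)%N ->
       frob_power I (p ^ e) (c * x ^+ (p ^ e))].

Definition strong_test_ideal (p : nat) T :=
  [/\ is_ideal T, T `&` off_min_primes !=set0
    & forall I, is_ideal I -> ideal_mul T (tight_closure p I) = ideal_mul T I].

Definition is_least (C : set (set R)) T := C T /\ forall J, C J -> T `<=` J.

End Ideals.

Arguments noetherian : clear implicits.
Arguments reduced : clear implicits.
Arguments off_min_primes : clear implicits.

(* [root_ring charRp e] is R^{1/q}, q = p^e: its elements are the formal roots
   s^{1/q}, s in R, with s^{1/q} + t^{1/q} = (s + t)^{1/q} and
   s^{1/q} t^{1/q} = (s t)^{1/q}, so it is a copy of the ring R.  It is an
   R-algebra through r |-> (r^q)^{1/q}, which is the inclusion of R in R^{1/q}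
   when R is reduced (lemmas [rootq_expq], [root_ring_expq_inj] and
   [root_ring_alg_inj]). *)
Definition root_ring (R : comNzRingType) (p : nat) of p \in [pchar R] &
  nat : predArgType := R.

Section RootRing.
Variables (R : comNzRingType) (p : nat) (charRp : p \in [pchar R]).

HB.instance Definition _ e := GRing.ComNzRing.on (@root_ring R p charRp e).

Definition rootq e (s : R) : root_ring charRp e := s.
Definition unrootq e (x : root_ring charRp e) : R := x.

Fact expr_pchar_add e (a b : R) :
  (a + b) ^+ (p ^ e) = a ^+ (p ^ e) + b ^+ (p ^ e).
Proof.
by apply: exprDn_pchar; rewrite pnatX pnatE ?charRp // (pcharf_prime charRp).
Qed.

Section Algebra.
Variable e : nat.
Local Notation Rq := (root_ring charRp e).

Definition root_scale (a : R) (x : Rq) : Rq := rootq e (a ^+ (p ^ e)) * x.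

Fact root_scaleA a b x : root_scale a (root_scale b x) = root_scale (a * b) x.
Proof. by rewrite /root_scale mulrA /rootq exprMn. Qed.

Fact root_scale1 : left_id 1 root_scale.
Proof. by move=> x; rewrite /root_scale /rootq expr1n mul1r. Qed.

Fact root_scaleDr : right_distributive root_scale +%R.
Proof. by move=> a x y; rewrite /root_scale mulrDr. Qed.

Fact root_scaleDl x : {morph root_scale^~ x : a b / a + b}.
Proof. by move=> a b; rewrite /root_scale /rootq expr_pchar_add mulrDl. Qed.

HB.instance Definition _ := GRing.Zmodule_isLmodule.Build R Rq
  root_scaleA root_scale1 root_scaleDr root_scaleDl.

Fact root_scaleAl (a : R) (x y : Rq) : a *: (x * y) = a *: x * y.
Proof. exact: mulrA. Qed.

HB.instance Definition _ := GRing.Lmodule_isLalgebra.Build R Rq root_scaleAl.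

Lemma rootq_expq (s : R) : rootq e s ^+ (p ^ e) = s%:A :> Rq.
Proof. by rewrite [RHS]mulr1. Qed.

Hypothesis redR : reduced R.

Lemma root_ring_expq_inj : injective (fun x : Rq => x ^+ (p ^ e)).
Proof.
move=> x y /= xy; apply/eqP; rewrite -subr_eq0; apply/eqP.
apply: (@redR (x - y) (p ^ e)%N); apply: (addIr ((y : R) ^+ (p ^ e))).
by rewrite add0r -expr_pchar_add subrK.
Qed.

Lemma root_ring_alg_inj : injective (fun r : R => r%:A : Rq).
Proof. by move=> r s /=; rewrite -!rootq_expq => /root_ring_expq_inj. Qed.

End Algebra.

(* The homogeneous piece of degree e of the Cartier algebra. *)
Local Notation Hom e := {linear root_ring charRp e -> R^o}.

Definition F_finite :=
  exists s : seq (root_ring charRp 1), forall x : root_ring charRp 1,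
    exists c : nat -> R, x = \sum_(i < size s) c i *: s`_i.

Definition compatible e (phi : Hom e) (J : set R) :=
  phi @` (rootq e @` J) `<=` J.

Definition is_test_ideal e (phi : Hom e) (T : set R) :=
  is_least [set J | [/\ is_ideal J, compatible phi J
                      & J `&` off_min_primes R !=set0]] T.

Section Product.
Variables (e d : nat) (phi : Hom e) (psi : Hom d).

(* psi^{1/p^e} : (s^{1/p^d})^{1/p^e} |-> psi(s^{1/p^d})^{1/p^e}. *)
Definition root_map (x : root_ring charRp (e + d)) : root_ring charRp e :=
  rootq e (psi (rootq d (unrootq x))).

Definition cartier_mul (x : root_ring charRp (e + d)) : R^o :=
  phi (root_map x).

Fact cartier_mul_linear : linear cartier_mul.
Proof.
move=> a x y; rewrite /cartier_mul -linearP; congr (phi _).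
have /(congr1 (rootq e)) := linearP psi (a ^+ (p ^ e)) (rootq d (unrootq x))
  (rootq d (unrootq y)).
apply: etrans; congr (rootq e (psi _)).
by congr (_ * _ + _); rewrite /rootq expnD exprM.
Qed.

HB.instance Definition _ :=
  GRing.isLinear.Build R (root_ring charRp (e + d)) R^o *:%R cartier_mul
    cartier_mul_linear.

End Product.

Definition cartier_one (x : root_ring charRp 0) : R^o := unrootq x.

Fact cartier_one_linear : linear cartier_one.
Proof. by []. Qed.

HB.instance Definition _ :=
  GRing.isLinear.Build R (root_ring charRp 0) R^o *:%R cartier_one
    cartier_one_linear.

(* A graded subring of the Cartier algebra, as the family of its homogeneous
   pieces. *)
Definition graded_subring (D : forall e, set (Hom e)) :=
  [/\ forall e, D e \0 /\ (forall phi psi, D e phi -> D e psi -> D e (phi \- psi)),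
      D 0%N cartier_one
    & forall e d phi psi, D e phi -> D d psi -> D (e + d)%N (cartier_mul phi psi)].

Definition cartier_pair (D : forall e, set (Hom e)) :=
  [/\ graded_subring D, D 0%N = setT
    & exists2 e, (0 < e)%N & D e <> [set \0]].

Definition compatible_alg (D : forall e, set (Hom e)) (J : set R) :=
  forall e, (0 < e)%N -> forall phi, D e phi -> compatible phi J.

Definition is_test_ideal_alg (D : forall e, set (Hom e)) (T : set R) :=
  is_least [set J | [/\ is_ideal J, compatible_alg D J
                      & J `&` off_min_primes R !=set0]] T.

End RootRing.

(* Main.v *)
Require Import Defs.
From mathcomp Require Import all_boot all_algebra.
From mathcomp Require Import boolp classical_sets.
From mathcomp Require Import ring.

Set Implicit Arguments.
Unset Strict Implicit.
Unset Printing Implicit Defensive.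

Import GRing.Theory.
Local Open Scope classical_set_scope.
Local Open Scope ring_scope.

(** The inclusion [T I <= T I^*] is immediate from [I <= I^*].  For the other
    one fix [x] in [I^*] and look at the ideal
      [K = {t in T | t x^q in T I^[q] for all q = p^f, f >= 0}].
    If [T] is compatible with [phi : R^{1/p^e} -> R], so is [K]: by
    [R]-linearity
      [phi(t^{1/p^e}) x^q = phi((t x^(q p^e))^{1/p^e})],
    which lies in [phi((T I^[q p^e])^{1/p^e})], hence in
    [I^[q] phi(T^{1/p^e})], hence in [T I^[q]].  Therefore, as soon as [K] meets
    [R^o], minimality of the test ideal [T] forces [K = T], and the condition
    for [q = 1] reads [t x \in T I] for all [t] in [T].  Because [K] involves
    all powers of [p] at once, it is compatible with maps of every degree, so
    the same argument serves one map [phi] and a whole Cartier algebra.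

    To see that [K] meets [R^o], multiply an element of [T] in [R^o] by some
    [g] in [R^o] with [g x^q \in I^[q]] for all [q], not only for large ones
    ([tight_closure_uniform_multiplier]).  Such [g] form an ideal, which
    contains the annihilator of [I], as well as [c i^(p^N)] for each [i] in [I]
    if [c] works for all [q >= p^N].  In a reduced ring this ideal thus has zero
    annihilator.  In a reduced Noetherian ring, an ideal with zero annihilator
    contains a nonzerodivisor ([exists_regular_of_ann_eq0]), and [R^o] is the
    set of nonzerodivisors ([regular_off_min_primes], [off_min_primes_regular]). *)

(** * Ideals *)

Section Ideals.
Variable R : comNzRingType.
Implicit Types (I J T A S : set R).

Lemma is_ideal_gen A : is_ideal (ideal_gen A).
Proof.
split=> [J [[J0 _ _] _]|x y Hx Hy J HJ|a x Hx J HJ] //.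
- by case: (HJ) => -[_ JD _] _; apply: JD; [apply: Hx|apply: Hy].
- by case: (HJ) => -[_ _ JM] _; apply: JM; apply: Hx.
Qed.

Lemma ideal_gen_mem A x : A x -> ideal_gen A x.
Proof. by move=> Ax J [_]; apply. Qed.

Lemma ideal_gen_sub A J : is_ideal J -> A `<=` J -> ideal_gen A `<=` J.
Proof. by move=> HJ AJ x; apply. Qed.

Lemma is_ideal_mul I J : is_ideal (ideal_mul I J).
Proof. exact: is_ideal_gen. Qed.

Lemma ideal_mul_mem I J x y : I x -> J y -> ideal_mul I J (x * y).
Proof. by move=> Ix Jy; apply: ideal_gen_mem; exists x, y. Qed.

Lemma ideal_mul_subr I J J' :
  J `<=` J' -> ideal_mul I J `<=` ideal_mul I J'.
Proof.
move=> JJ'; apply: ideal_gen_sub; first exact: is_ideal_mul.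
by move=> _ [x [y [Ix /JJ' J'y ->]]]; apply: ideal_mul_mem.
Qed.

Definition ann S : set R := [set a | forall s, S s -> a * s = 0].

Lemma is_ideal_ann S : is_ideal (ann S).
Proof.
split=> [s _|x y Hx Hy s Ss|a x Hx s Ss]; first by rewrite mul0r.
- by rewrite mulrDl Hx // Hy // addr0.
- by rewrite -mulrA Hx // mulr0.
Qed.

(** * Maximal elements in Noetherian rings *)

Lemma chain_finite_sub (F : set (set R)) (s : seq R) :
  F !=set0 -> total_on F subset -> [set` s] `<=` \bigcup_(X in F) X ->
  exists2 X, F X & [set` s] `<=` X.
Proof.
move=> F0 totF; elim: s => [_|x s IHs sU]; first by case: F0 => X FX; exists X.
have [|X FX sX] := IHs.
  by move=> y /= ys; apply: sU => /=; rewrite inE ys orbT.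
have [|Y FY Yx] := sU x; first by rewrite /= mem_head.
have [XY|YX] := totF X Y FX FY.
- exists Y => // y /=; rewrite inE => /orP[/eqP->//|ys]; apply/XY/sX.
  exact: ys.
- exists X => // y /=; rewrite inE => /orP[/eqP->|/sX//]; exact: YX.
Qed.

Lemma noetherian_maximal (C : set (set R)) :
  noetherian R -> C !=set0 -> (forall J, C J -> is_ideal J) ->
  exists2 J, C J & forall J', C J' -> J `<=` J' -> J' = J.
Proof.
move=> noeth [J0 CJ0] Cideal.
(* [set0] is added to [C] as the union of the empty chain; being smaller than
   any ideal, it is not maximal. *)
have [F FC totF|A [CA Amax]] := @Zorn_bigcup R [set X | C X \/ X = set0].
  set U := \bigcup_(X in F) X.
  have [->|/set0P[x [X FX Xx]]] := eqVneq U set0; first by right.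
  have CF Y y : F Y -> Y y -> C Y.
    by move=> /FC[//|->].
  have CX := CF _ _ FX Xx.
  have Uideal : is_ideal U.
    split; first by exists X => //; case: (Cideal _ CX).
    - move=> y z [Y FY Yy] [Z FZ Zz].
      have [_ YD _] := Cideal _ (CF _ _ FY Yy).
      have [_ ZD _] := Cideal _ (CF _ _ FZ Zz).
      have [YZ|ZY] := totF _ _ FY FZ.
      + by exists Z => //; apply: ZD => //; apply: YZ.
      + by exists Y => //; apply: YD => //; apply: ZY.
    - move=> a y [Y FY Yy]; exists Y => //.
      by case: (Cideal _ (CF _ _ FY Yy)) => _ _; apply.
  have [s Us] := noeth U Uideal.
  have [||y sy|Y [FY CY] sY] := @chain_finite_sub [set Y | F Y /\ C Y] s.
  - by exists X.
  - by move=> Y Z [FY _] [FZ _]; apply: totF.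
  - have [Y FY Yy] : U y by rewrite Us; apply: ideal_gen_mem.
    by exists Y => //; split=> //; apply: CF Yy.
  left; suff -> : U = Y by [].
  apply/seteqP; split=> [|y Yy]; last by exists Y.
  by rewrite Us; apply: ideal_gen_sub => //; apply: Cideal.
have {}Amax J : C J -> A `<=` J -> J = A.
  move=> CJ AJ; apply: contrapT => JA; apply: (Amax J); last by left.
  by split=> // /(conj AJ)/seteqP/esym.
exists A => //; case: CA => // A0.
have := Amax _ CJ0; rewrite A0 => /(_ (sub0set _)) J00.
by have [] := Cideal _ CJ0; rewrite J00.
Qed.

(** * Multiplicative sets and primes *)

(** An ideal maximal among those that miss the multiplicative set [S] is
    prime. *)
Lemma exists_prime_disjoint S :
  noetherian R -> S 1 -> (forall x y, S x -> S y -> S (x * y)) -> ~ S 0 ->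
  exists2 P, prime_ideal P & forall x, P x -> ~ S x.
Proof.
move=> noeth S1 SM S0.
have [||P [Pideal PS] Pmax] :=
    @noetherian_maximal [set J | is_ideal J /\ forall x, J x -> ~ S x] noeth.
- exists [set 0]; split=> [|x ->//].
  by split=> [//|x y -> ->|a x ->]; [exact: addr0|exact: mulr0].
- by move=> J [].
exists P => //; have [P0 PD PM] := Pideal.
split=> // [/PS//|x y Pxy].
(* By maximality of [P], the larger ideal [P + z R] meets [S]. *)
have meetS z : ~ P z -> exists q r, P q /\ S (q + z * r).
  move=> Pz; apply: contrapT => noqr.
  pose J := [set w | exists q r, P q /\ w = q + z * r].
  have JP : J = P.
    apply: Pmax => [|w Pw]; last by exists w, 0; rewrite mulr0 addr0.
    split=> [|w [q [r [Pq ->]]] Sw]; last by apply: noqr; exists q, r.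
    split; first by exists 0, 0; rewrite mulr0 addr0.
    - move=> _ _ [q [r [Pq ->]]] [q' [r' [Pq' ->]]].
      by exists (q + q'), (r + r'); split; [exact: PD|ring].
    - move=> a _ [q [r [Pq ->]]].
      by exists (a * q), (a * r); split; [exact: PM|ring].
  by apply: Pz; rewrite -JP; exists 0, 1; rewrite mulr1 add0r.
apply: contrapT => /not_orP[/meetS[q [r [Pq Sx]]] /meetS[q' [r' [Pq' Sy]]]].
apply: (PS _ _ (SM _ _ Sx Sy)).
have -> : (q + x * r) * (q' + y * r') =
          (q' + y * r') * q + (x * r * q' + r * r' * (x * y)) by ring.
by apply: (PD); [apply: PM|apply: (PD); apply: PM].
Qed.

(** If [g] lies in a minimal prime [P], some [s] outside [P] has [s g^n = 0]:
    otherwise a prime missing all [s g^n] would lie in [P] and differ from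
    it. *)
Lemma regular_off_min_primes (g : R) :
  noetherian R -> (forall y, y * g = 0 -> y = 0) -> off_min_primes R g.
Proof.
move=> noeth greg [P [[Pideal P1 Pprime] Pmin] Pg].
have [P0 _ _] := Pideal.
have gXreg n y : y * g ^+ n = 0 -> y = 0.
  elim: n => [|n IHn]; first by rewrite mulr1.
  by rewrite exprSr mulrA => /greg.
pose S := [set a | exists s n, ~ P s /\ a = s * g ^+ n].
have [|_ _ [s [n [Ps ->]]] [t [k [Pt ->]]]|[s [n [Ps /esym/gXreg s0]]]|
    Q Qprime QS] := @exists_prime_disjoint S noeth.
- by exists 1, 0%N; rewrite mulr1.
- by exists (s * t), (n + k)%N; split; [case/Pprime|rewrite exprD; ring].
- by apply: Ps; rewrite s0.
have QP : Q = P.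
  apply: Pmin => // a Qa; apply: contrapT => Pa; apply: (QS a Qa).
  by exists a, 0%N; rewrite mulr1.
by apply: (QS g); [rewrite QP|exists 1, 1%N; rewrite mul1r].
Qed.

End Ideals.

(** * Zero divisors in reduced Noetherian rings *)

Section Reduced.
Variable R : comNzRingType.
Hypotheses (noeth : noetherian R) (redR : reduced R).
Implicit Types (I A : set R).

Lemma reduced_mul_exp (y z : R) n : (0 < n)%N -> y * z ^+ n = 0 -> y * z = 0.
Proof.
case: n => // n _ yz0; apply: (@redR _ n.+1).
by rewrite exprMn exprS mulrAC yz0 mul0r.
Qed.

(** The annihilators of single nonzero elements that kill [c] have a maximal
    member [ann [set z]], an associated prime.  It is minimal because [z^2 != 0]
    keeps [z] out of every prime inside it, and such a prime contains
    [0 = a z] for all [a] in [ann [set z]]. *)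
Lemma off_min_primes_regular (c : R) :
  off_min_primes R c -> forall y, y * c = 0 -> y = 0.
Proof.
move=> offc y yc0; apply: contrapT => y0; apply: offc.
have [||P [z [z0 zc0 ->]] zmax] := @noetherian_maximal R
    [set A | exists z, [/\ z <> 0, z * c = 0 & A = ann [set z]]] noeth.
- by exists (ann [set y]), y.
- by move=> _ [z [_ _ ->]]; apply: is_ideal_ann.
have annE w a : ann [set w] a <-> a * w = 0 by split=> [->//|aw0 _ ->].
exists (ann [set z]); last by apply/annE; rewrite mulrC.
split=> [|Q [[Q0 _ QM] _ Qprime] Qz].
  split; first exact: is_ideal_ann.
  - by move=> /annE; rewrite mul1r.
  - move=> a b /annE abz0; have [bz0|/eqP bz0] := eqVneq (b * z) 0.
      by right; apply/annE.
    left; rewrite -(zmax (ann [set b * z])); first by apply/annE; rewrite mulrA.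
      by exists (b * z); split=> //; rewrite -mulrA zc0 mulr0.
    by move=> d /annE dz0; apply/annE; rewrite mulrCA dz0 mulr0.
apply/seteqP; split=> // a /annE az0.
have [//|/Qz/annE zz0] : Q a \/ Q z by apply: Qprime; rewrite az0.
by case: z0; apply: (@redR _ 2%N).
Qed.

(** Choose [g] in [A] with [ann [set g]] minimal, which is to say with a maximal
    double annihilator.  If [y g = 0] but [a y != 0] for some [a] in [A], then
    [g] and [h = a y] have product zero, so [ann [set g + h]] is the
    intersection of [ann [set g]] and [ann [set h]]; it no longer contains
    [y], as [a y^2 != 0] in a reduced ring. *)
Lemma exists_regular_of_ann_eq0 A :
  is_ideal A -> (forall y, ann A y -> y = 0) ->
  exists2 g, A g & forall y, y * g = 0 -> y = 0.
Proof.
move=> [A0 AD AM] annA0.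
have [||_ [g Ag ->] gmax] := @noetherian_maximal R
    [set J | exists2 g, A g & J = ann (ann [set g])] noeth.
- by exists (ann (ann [set 0])), 0.
- by move=> _ [g _ ->]; apply: is_ideal_ann.
exists g => // y yg0; apply: annA0 => a Aa.
have yg : ann [set g] y by move=> _ ->.
pose h := y * a.
have gh0 : g * h = 0 by rewrite /h mulrA (mulrC g) yg0 mul0r.
have Agh : A (g + h) by apply: AD => //; apply: AM.
have annD : ann [set g + h] `<=` ann [set g].
  move=> w wgh _ ->; have {}wgh : w * (g + h) = 0 by apply: wgh.
  apply: (@reduced_mul_exp w g 2) => //.
  have -> : w * g ^+ 2 = w * (g + h) * g - w * (g * h) by ring.
  by rewrite wgh gh0 mul0r mulr0 subr0.
have annann : ann (ann [set g + h]) = ann (ann [set g]).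
  by apply: gmax; [exists (g + h)|move=> w wg s /annD/wg].
have : (g + h) * y = 0.
  suff : ann (ann [set g]) (g + h) by apply.
  by rewrite -annann => w /(_ (g + h) erefl); rewrite mulrC.
rewrite mulrDl (mulrC g) yg0 add0r => hy0.
by rewrite mulrC; apply: (@reduced_mul_exp a y 2) => //; rewrite -hy0 /h; ring.
Qed.

(** * Uniform multipliers for tight closure *)

Variable p : nat.
Hypothesis charRp : p \in [pchar R].

Lemma pchar_expn_gt0 f : (0 < p ^ f)%N.
Proof. by rewrite expn_gt0 prime_gt0 // (pcharf_prime charRp). Qed.

Lemma frob_power_mem I q x : I x -> frob_power I q (x ^+ q).
Proof. by move=> Ix; apply: ideal_gen_mem; exists x. Qed.

Lemma sub_tight_closure I : I `<=` tight_closure p I.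
Proof.
move=> x Ix; exists 1.
  by apply: regular_off_min_primes => // y; rewrite mulr1.
by exists 0%N => f _; rewrite mul1r; apply: frob_power_mem.
Qed.

Lemma frob_power1 I : is_ideal I -> frob_power I (p ^ 0) `<=` I.
Proof. by move=> HI; apply: ideal_gen_sub => // _ [x Ix <-]. Qed.

(** The ideal [A] of all uniform multipliers of [x] contains [ann I]: if [y]
    kills [I], then [y c x^q = 0] for [q] large, and [c] is a nonzerodivisor, so
    [y x = 0].  It also contains [c i^(p^N)] for [i] in [I]: this works for large
    exponents because of [c], and for the others because of [i].  If [y] kills
    [A], it therefore kills [I], lies in [A], and has square zero. *)
Lemma tight_closure_uniform_multiplier I x :
  tight_closure p I x ->
  exists2 g, off_min_primes R g &
    forall f, frob_power I (p ^ f) (g * x ^+ (p ^ f)).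
Proof.
move=> [c offc [N cx]].
pose A : set R := [set g | forall f, frob_power I (p ^ f) (g * x ^+ (p ^ f))].
have Aideal : is_ideal A.
  split=> [f|a b Aa Ab f|a b Ab f]; rewrite ?mul0r ?mulrDl -?mulrA;
    have [F0 FD FM] := is_ideal_gen [set z ^+ (p ^ f) | z in I] => //.
  - by apply: FD; [apply: Aa|apply: Ab].
  - by apply: FM; apply: Ab.
have cI i : I i -> A (c * i ^+ (p ^ N)).
  move=> Ii f; have [_ _ FM] := is_ideal_gen [set z ^+ (p ^ f) | z in I].
  have [Nf|/ltnW fN] := leqP N f.
    by rewrite mulrAC mulrC; apply: FM; apply: cx.
  have -> : (p ^ N = p ^ f * (p ^ (N - f)).-1 + p ^ f)%N.
    by rewrite -mulnSr prednK ?pchar_expn_gt0 // -expnD subnKC.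
  rewrite exprD mulrA mulrAC; apply: FM; exact: frob_power_mem.
have annI y : ann I y -> A y.
  move=> yI f; suff -> : y * x ^+ (p ^ f) = 0.
    by have [] := is_ideal_gen [set z ^+ (p ^ f) | z in I].
  suff yx0 : y * x = 0.
    by rewrite -(prednK (pchar_expn_gt0 f)) exprS mulrA yx0 mul0r.
  apply: (reduced_mul_exp (pchar_expn_gt0 N)).
  apply: (off_min_primes_regular offc); rewrite -mulrA mulrC (mulrC _ c).
  suff /(_ _ (cx N (leqnn N))) : frob_power I (p ^ N) `<=` ann [set y].
    by apply.
  apply: ideal_gen_sub; first exact: is_ideal_ann.
  move=> _ [i Ii <-] _ ->; rewrite mulrC.
  by rewrite -(prednK (pchar_expn_gt0 N)) exprS mulrA yI // mul0r.
have [y yA|g Ag greg] := exists_regular_of_ann_eq0 Aideal; last first.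
  by exists g => //; apply: regular_off_min_primes.
suff yI : ann I y by apply: (@redR _ 2%N); apply: yA; apply: annI.
move=> i Ii; apply: (reduced_mul_exp (pchar_expn_gt0 N)).
apply: (off_min_primes_regular offc); rewrite -mulrA (mulrC _ c).
by apply: yA; apply: cI.
Qed.

(** * Compatible ideals *)

Local Notation Hom e := {linear root_ring charRp e -> R^o}.

Lemma linear_rootq_mul e (phi : Hom e) f s i :
  phi (rootq charRp e (s * i ^+ (p ^ (e + f)))) =
  phi (rootq charRp e s) * i ^+ (p ^ f).
Proof.
have -> : rootq charRp e (s * i ^+ (p ^ (e + f))) =
          i ^+ (p ^ f) *: rootq charRp e s.
  rewrite [RHS](_ : _ = (i ^+ (p ^ f)) ^+ (p ^ e) * s) //.
  by rewrite -exprM -expnD addnC mulrC.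
by rewrite linearZ /= [_ *: _]mulrC.
Qed.

(** An element of [I] raised to the power [p^(e + f)] comes out of [phi] with
    exponent [p^f], and what remains inside has its image in [T]. *)
Lemma compatible_mul_frob_power e (phi : Hom e) T I f z :
  is_ideal T -> compatible phi T ->
  ideal_mul T (frob_power I (p ^ (e + f))) z ->
  ideal_mul T (frob_power I (p ^ f)) (phi (rootq charRp e z)).
Proof.
move=> [_ _ TM] compT.
set B := ideal_mul T (frob_power I (p ^ f)).
have [B0 BD BM] : is_ideal B by exact: is_ideal_mul.
(* Multiplication by an arbitrary [r] inside [phi] makes [M] an ideal. *)
pose M : set R := [set z | forall r, B (phi (rootq charRp e (r * z)))].
have Mideal : is_ideal M.
  split=> [r|y w My Mw r|a y My r].
  - by rewrite mulr0 (_ : rootq _ _ 0 = 0) // linear0.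
  - rewrite mulrDr (_ : rootq _ _ (_ + _) =
      rootq charRp e (r * y) + rootq charRp e (r * w)) // linearD.
    by apply: BD; [apply: My|apply: Mw].
  - by rewrite mulrA; apply: My.
suff MT : ideal_mul T (frob_power I (p ^ (e + f))) `<=` M.
  by move=> /MT/(_ 1); rewrite mul1r.
apply: ideal_gen_sub => // _ [t [u [Tt Iu ->]]].
suff : frob_power I (p ^ (e + f)) `<=` [set u | M (t * u)] by apply.
have [M0 MD MM] := Mideal.
apply: ideal_gen_sub => [|_ [i Ii <-] r /=].
  split=> [|y w|a y] /=; first by rewrite mulr0.
  - by rewrite mulrDr; apply: MD.
  - by rewrite mulrCA; apply: MM.
rewrite mulrA linear_rootq_mul; apply: ideal_mul_mem; last first.
  exact: frob_power_mem.
apply: compT; exists (rootq charRp e (r * t)) => //.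
by exists (r * t) => //; apply: TM.
Qed.

Definition uniform_multipliers T I x : set R :=
  [set t | T t /\
    forall f, ideal_mul T (frob_power I (p ^ f)) (t * x ^+ (p ^ f))].

Lemma is_ideal_uniform_multipliers T I x :
  is_ideal T -> is_ideal (uniform_multipliers T I x).
Proof.
move=> [T0 TD TM].
have B f := is_ideal_mul T (frob_power I (p ^ f)).
split.
- by split=> // f; rewrite mul0r; have [] := B f.
- move=> a b [Ta Ba] [Tb Bb]; split=> [|f]; first exact: TD.
  by rewrite mulrDl; have [_ BD _] := B f; apply: BD.
- move=> a b [Tb Bb]; split=> [|f]; first exact: TM.
  by rewrite -mulrA; have [_ _ BM] := B f; apply: BM.
Qed.

(** A map of degree [e] reduces the condition for [f] to the one for [e + f],
    which is why [uniform_multipliers] imposes the condition for all [f]. *)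
Lemma compatible_uniform_multipliers e (phi : Hom e) T I x :
  is_ideal T -> compatible phi T ->
  compatible phi (uniform_multipliers T I x).
Proof.
move=> Tideal compT _ [_ [t [Tt Bt] <-] <-]; split=> [|f].
  by apply: compT; exists (rootq charRp e t) => //; exists t.
by rewrite -linear_rootq_mul; apply: compatible_mul_frob_power.
Qed.

(** The property [C] stands for compatibility with a single map or with a
    Cartier algebra. *)
Lemma strong_test_ideal_of_least (C : set R -> Prop) T :
  (forall J I x, is_ideal J -> C J -> C (uniform_multipliers J I x)) ->
  is_least [set J | [/\ is_ideal J, C J & J `&` off_min_primes R !=set0]] T ->
  strong_test_ideal p T.
Proof.
move=> Cmult [[Tideal CT Toff] Tmin]; split=> // I HI.
apply/seteqP; split; last first.
  by apply: ideal_mul_subr; apply: sub_tight_closure.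
apply: ideal_gen_sub; first exact: is_ideal_mul.
move=> _ [t [x [Tt Ix ->]]].
have [g offg gx] := tight_closure_uniform_multiplier Ix.
have TK : T `<=` uniform_multipliers T I x.
  apply: Tmin; split; [exact: is_ideal_uniform_multipliers|exact: Cmult|].
  have [_ _ TM] := Tideal.
  have [s [Ts offs]] := Toff; exists (g * s); split.
    split=> [|f]; first exact: TM.
    by rewrite (mulrC g) -mulrA; apply: ideal_mul_mem.
  move=> [P Pmin]; have [[_ _ Pprime] _] := Pmin.
  by case/Pprime=> [Pg|Ps]; [apply: offg|apply: offs]; exists P.
have [_ /(_ 0%N)] := TK t Tt; rewrite expr1.
by apply: ideal_mul_subr; apply: frob_power1.
Qed.

End Reduced.

Theorem theorem2p11 (R : comNzRingType) (p : nat) (charRp : p \in [pchar R])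
    (m : set R) (hloc : local_ring m) (hnoeth : noetherian R)
    (hFfin : F_finite charRp) (hred : reduced R) :
  (forall (e : nat) (he : (0 < e)%N)
      (phi : {linear root_ring charRp e -> R^o}) (T : set R),
      is_test_ideal phi T -> strong_test_ideal p T)
  /\
  (forall (D : forall e : nat, set {linear root_ring charRp e -> R^o}),
      cartier_pair D ->
      forall T : set R, is_test_ideal_alg D T -> strong_test_ideal p T).
Proof.
split=> [e _ phi T|D _ T]; apply: strong_test_ideal_of_least => //.
- by move=> J I x Jideal compJ; apply: compatible_uniform_multipliers.
- move=> J I x Jideal compJ e e0 phi Dphi.
  by apply: compatible_uniform_multipliers => //; apply: compJ Dphi.
Qed.
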